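(* Let $\kappa\in(0,1)$, let $\nu$ be a $\kappa$-regular Borel probability measure on $\mathbb R$ such that $\hat\kappa_1(\nu)>1/2$, and let $K=\mathrm{supp}(\nu)$. Then: (a) there exist an effectively-computable $\varrho>0$ and $C>0$ such that $\mathcal N_K(T)\le C\,T^{2\kappa-\varrho}$ for all integers $T\ge1$; (b) there exists an effectively-computable $\varrho>0$ such that $\nu(W_K(2-\varrho))=0$.
   Context: A Borel measure $\nu$ on $\mathbb R$ is $\kappa$-regular (AD-regular with exponent $\kappa$) if there is a constant $C>1$ such that $C^{-1}r^\kappa\le\nu(B_r(x))\le Cr^\kappa$ for all $x\in\mathrm{supp}(\nu)$ and all sufficiently small $r>0$, where $B_r(x)$ is the interval of radius $r$ centred at $x$. Write $e(x)=e^{2\pi i x}$ and, for $\xi\in\mathbb Z$, $\hat\nu(\xi)=\int e(-\xi x)\,d\nu(x)$. The Fourier $\ell^1$ dimension is $\hat\kappa_1(\nu)=\sup\{s\ge0:\ \exists C_s \text{ with } \sum_{\xi=0}^Q|\hat\nu(\xi)|\le C_sQ^{1-s}\text{ for all } Q\ge1\}$. For compact $K$ and integer $T\ge1$, $\mathcal N_K(T)=\#\{x\in K: qx\in\mathbb Z\text{ for some integer }1\le q\le T\}$. For closed $K$ and $\alpha\ge1$, $W_K(\alpha)$ is the set of $x\in\mathbb R$ for which $|x-p/q|<q^{-\alpha}$ with $p/q\in K$ has infinitely many solutions $(p,q)\in\mathbb Z\times\mathbb N$. *)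

(* Defs.v *)
From HB Require Import structures.
From mathcomp Require Import all_boot all_order all_algebra.
From mathcomp Require Import all_classical all_reals all_analysis.
From mathcomp.real_closed Require Import complex.

Set Implicit Arguments.
Unset Strict Implicit.
Unset Printing Implicit Defensive.

Import Order.TTheory GRing.Theory Num.Theory.
Import numFieldNormedType.Exports.

Local Open Scope classical_set_scope.
Local Open Scope ring_scope.

Section FourierDimension.
Variable R : realType.
Implicit Types (nu : probability (measurableTypeR R) R) (K : set R).

Definition supp nu : set R :=
  [set x | forall U : set R, open U -> U x -> (0 < nu U)%E].

(* "Sufficiently small r" is uniform in x: for a probability measure this makes
   the support bounded, hence compact. *)
Definition AD_regular (kappa : R) nu : Prop :=
  exists C r0 : R, [/\ 1 < C, 0 < r0 &
    forall x r : R, supp nu x -> 0 < r < r0 ->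
      ((C^-1 * r `^ kappa)%:E <= nu (ball x r) <= (C * r `^ kappa)%:E)%E].

Definition e2pii (x : R) : R[i] := (cos (2 * pi * x) +i* sin (2 * pi * x))%C.

Definition complex_integral nu (f : R -> R[i]) : R[i] :=
  (\int[nu]_x complex.Re (f x) +i* \int[nu]_x complex.Im (f x))%C.

Definition fourier_coef nu (xi : int) : R[i] :=
  complex_integral nu (fun x => e2pii (- (xi%:~R * x))).

(* [ComplexField.Normc.normc] is the R-valued modulus. *)
Definition fourier_l1_dim nu : \bar R :=
  ereal_sup [set s%:E | s in [set s : R | 0 <= s /\
    exists C : R, forall Q : nat, (1 <= Q)%N ->
      \sum_(0 <= xi < Q.+1) ComplexField.Normc.normc (fourier_coef nu xi%:Z)
        <= C * Q%:R `^ (1 - s)]].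

(* [counting] is +oo on infinite sets. *)
Definition rational_count K (T : nat) : \bar R :=
  counting [set x : R | K x /\
    exists q : nat, (1 <= q <= T)%N /\ q%:R * x \is a Num.int].

Definition W_set K (alpha : R) : set R :=
  [set x : R | infinite_set [set pq : int * nat |
    [/\ (0 < pq.2)%N, K (pq.1%:~R / pq.2%:R) &
        `|x - pq.1%:~R / pq.2%:R| < pq.2%:R `^ (- alpha)]]].

End FourierDimension.

(* The total mu-recursive functions.  Each closure rule characterises the new
   function by its defining equations; in [recursive_min] the existence of [f]
   is exactly the totality of the minimisation. *)
Inductive recursive : forall n : nat, (n.-tuple nat -> nat) -> Prop :=
| recursive_zero n (f : n.-tuple nat -> nat) :
    (forall v, f v = 0%N) -> recursive f
| recursive_succ (f : 1.-tuple nat -> nat) :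
    (forall v, f v = (thead v).+1) -> recursive f
| recursive_proj n (i : 'I_n) (f : n.-tuple nat -> nat) :
    (forall v, f v = tnth v i) -> recursive f
| recursive_comp m n (g : m.-tuple nat -> nat) (h : 'I_m -> n.-tuple nat -> nat)
    (f : n.-tuple nat -> nat) :
    recursive g -> (forall i, recursive (h i)) ->
    (forall v, f v = g [tuple h i v | i < m]) -> recursive f
| recursive_prim n (g : n.-tuple nat -> nat) (h : n.+2.-tuple nat -> nat)
    (f : n.+1.-tuple nat -> nat) :
    recursive g -> recursive h ->
    (forall v : n.-tuple nat, f [tuple of 0%N :: v] = g v) ->
    (forall (v : n.-tuple nat) (m : nat), f [tuple of m.+1 :: v]
       = h [tuple of m :: f [tuple of m :: v] :: v]) ->
    recursive f
| recursive_min n (g : n.+1.-tuple nat -> nat) (f : n.-tuple nat -> nat) :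
    recursive g ->
    (forall v : n.-tuple nat, g [tuple of f v :: v] = 0%N /\
       forall m : nat, (m < f v)%N -> g [tuple of m :: v] <> 0%N) ->
    recursive f.

(* Computability on nonnegative rationals, presented as fractions of naturals;
   the values of [rho] at negative arguments are unconstrained. *)
Definition computable (rho : rat -> rat -> rat) : Prop :=
  exists num den : 4.-tuple nat -> nat, [/\ recursive num, recursive den &
    forall a b c d : nat, (0 < b)%N -> (0 < d)%N ->
      (0 < den [tuple a; b; c; d])%N /\
      rho (a%:R / b%:R) (c%:R / d%:R)
        = (num [tuple a; b; c; d])%:R / (den [tuple a; b; c; d])%:R].

(* Main.v *)
Require Import Defs.
From mathcomp Require Import all_boot all_order all_algebra.
From mathcomp Require Import all_classical all_reals all_analysis.
From mathcomp Require Import finmap measurable_realfun ring lra zify.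
From mathcomp.real_closed Require Import complex.

Set Implicit Arguments.
Unset Strict Implicit.
Unset Printing Implicit Defensive.

Import Order.TTheory GRing.Theory Num.Theory.
Import numFieldNormedType.Exports.

Local Open Scope classical_set_scope.
Local Open Scope ring_scope.

(* Let K be the support, take v > 0 with (1 + v)/2 below the l^1 dimension, and
   let N be about T^(2 + v). The points of K with denominator at most T are
   T^-2-separated, so the balls of radius 1/(8N) around them are disjoint,
   each of mass at least about N^-kappa. In these balls, for some q <= T,
   the squared exponential sum |sum_(m < N/q) e(m q x)|^2 is comparable to
   its maximum (N/q)^2; by Markov's inequality the set of such x has mass at
   most about (q/N) sum_(d < N/q) |nu^(d q)|. Summed over q <= T, the
   divisor bound and the l^1 decay of nu^ give O(T/N (T + N^((1 - v)/2))),
   which is O(T^2/N) by the choice of N. Hence there are O(T^2 N^(kappa - 1))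
   points; as kappa < 1 this beats T^(2 kappa) by a power of T, which is (a).
   Part (b) is Borel-Cantelli over dyadic ranges of denominators. *)

(** * Recursive functions and the computable exponent *)

Definition recursive1 (f : nat -> nat) : Prop :=
  recursive (fun v : 1.-tuple nat => f (thead v)).

Definition recursive2 (f : nat -> nat -> nat) : Prop :=
  recursive (fun v : 2.-tuple nat => f (thead v) (tnth v ord_max)).

Lemma recursive_comp1 (n : nat) (f : nat -> nat) (a : n.-tuple nat -> nat) :
  recursive1 f -> recursive a -> recursive (fun v => f (a v)).
Proof.
move=> rf ra; apply: (recursive_comp rf (fun=> ra)) => v.
by rewrite /thead tnth_mktuple.
Qed.

Lemma recursive_comp2 (n : nat) (f : nat -> nat -> nat)
    (a b : n.-tuple nat -> nat) :
  recursive2 f -> recursive a -> recursive b ->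
  recursive (fun v => f (a v) (b v)).
Proof.
move=> rf ra rb; pose ab (i : 'I_2) := if i == ord0 then a else b.
have rab i : recursive (ab i) by rewrite /ab; case: ifP.
by apply: (recursive_comp rf rab) => v; rewrite /thead !tnth_mktuple.
Qed.

Lemma recursive1_id : recursive1 id.
Proof. exact: (@recursive_proj 1 ord0). Qed.

Lemma recursive1_succ : recursive1 succn.
Proof. exact: recursive_succ. Qed.

Lemma recursive_const (n c : nat) : recursive (fun _ : n.-tuple nat => c).
Proof.
elim: c => [|c IH]; first exact: recursive_zero.
exact: (recursive_comp1 recursive1_succ IH).
Qed.

Lemma recursive2_iter (base : nat -> nat) (next f : nat -> nat -> nat) :
  recursive1 base -> recursive2 next ->
  (forall y, f 0%N y = base y) ->
  (forall x y, f x.+1 y = next (f x y) y) -> recursive2 f.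
Proof.
move=> rbase rnext f0 fS; pose value := Ordinal (isT : 1 < 3)%N.
apply: (@recursive_prim 1 _
  (fun v => next (tnth v value) (tnth v ord_max)) _ rbase).
- by apply: recursive_comp2 => //; exact: recursive_proj.
- by case/tupleP => y v; exact: (f0 y).
- by case/tupleP => y v m; exact: (fS m y).
Qed.

Lemma recursive2_addn : recursive2 addn.
Proof.
apply: (recursive2_iter (next := fun r _ => r.+1) recursive1_id) => //.
by apply: (recursive_comp1 recursive1_succ); exact: recursive_proj.
Qed.

Lemma recursive2_muln : recursive2 muln.
Proof.
apply: (recursive2_iter (base := fun=> 0%N) (next := fun r y => y + r)%N) => //.
- exact: recursive_const.
- by apply: (recursive_comp2 recursive2_addn); exact: recursive_proj.
Qed.

Lemma recursive1_pred : recursive1 predn.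
Proof.
apply: (@recursive_prim 0 (fun=> 0%N) (fun v => thead v)) => //.
- exact: recursive_zero.
- exact: (@recursive_proj 2 ord0).
Qed.

Lemma recursive2_subn : recursive2 subn.
Proof.
have rsub : recursive2 (fun x y => y - x)%N.
  apply: (recursive2_iter (next := fun r _ => r.-1) recursive1_id).
  - by apply: (recursive_comp1 recursive1_pred); exact: recursive_proj.
  - exact: subn0.
  - by move=> x y; rewrite subnS.
by apply: (recursive_comp2 rsub); exact: recursive_proj.
Qed.

(* For s > 1/2 the second factor is some v in ]0, 1] with (1 + v)/2 < s.  The
   maxima make the numerator a product of truncated subtractions. *)
Definition rho_exponent (k s : rat) : rat :=
  Num.max (1 - k) 0 * (Num.max (2 * s - 1) 0 / (2 * s + 1)).

Lemma max_subr_nat (F : realDomainType) (m n : nat) :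
  Num.max (m%:R - n%:R) 0 = (m - n)%:R :> F.
Proof.
case: (leqP n m) => [nm|/ltnW mn].
  by rewrite natrB // max_l // subr_ge0 ler_nat.
by rewrite (eqP (mn : (m - n == 0)%N)) max_r // subr_le0 ler_nat.
Qed.

Lemma rho_exponent_nat (a b c d : nat) : (0 < b)%N -> (0 < d)%N ->
  rho_exponent (a%:R / b%:R) (c%:R / d%:R)
    = ((b - a) * (2 * c - d))%:R / (b * (2 * c + d))%:R.
Proof.
move=> b0 d0; have bR : b%:R != 0 :> rat by rewrite pnatr_eq0 -lt0n.
have dR : d%:R != 0 :> rat by rewrite pnatr_eq0 -lt0n.
have cdR : 2 * c%:R + d%:R != 0 :> rat.
  by rewrite -natrM -natrD pnatr_eq0 -lt0n addn_gt0 d0 orbT.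
have maxrM (x y : rat) : 0 < y -> Num.max (x / y) 0 = Num.max x 0 / y.
  by move=> y0; rewrite maxr_pMl ?invr_ge0 1?ltW // mul0r.
rewrite !natrM -!max_subr_nat natrD natrM /rho_exponent.
have -> : 1 - a%:R / b%:R = (b%:R - a%:R) / b%:R :> rat by field.
have -> : 2 * (c%:R / d%:R) - 1 = (2 * c%:R - d%:R) / d%:R :> rat by field.
by rewrite !maxrM ?ltr0n //; field; rewrite bR dR cdR.
Qed.

Lemma computable_rho_exponent : computable rho_exponent.
Proof.
pose arg i (lt_i4 : (i < 4)%N) (v : 4.-tuple nat) := tnth v (Ordinal lt_i4).
pose a := arg 0%N isT; pose b := arg 1%N isT.
pose c := arg 2%N isT; pose d := arg 3%N isT.
have [ra rb rc rd] : [/\ recursive a, recursive b, recursive c & recursive d].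
  by split; exact: recursive_proj.
have r2c : recursive (fun v => 2 * c v)%N.
  by apply: (recursive_comp2 recursive2_muln) => //; exact: recursive_const.
exists (fun v => (b v - a v) * (2 * c v - d v))%N.
exists (fun v => b v * (2 * c v + d v))%N; split.
- by apply: (recursive_comp2 recursive2_muln);
    apply: (recursive_comp2 recursive2_subn).
- by apply: (recursive_comp2 recursive2_muln) => //;
    apply: (recursive_comp2 recursive2_addn).
move=> {ra rb rc rd r2c}; rewrite {}/a {}/b {}/c {}/d {}/arg => a b c d b0 d0.
rewrite !(tnth_nth 0%N) /= rho_exponent_nat //.
by rewrite muln_gt0 b0 addn_gt0 d0 orbT.
Qed.

Lemma rho_exponent_gt0_le1 (k s : rat) : 0 < k < 1 -> 2^-1 < s ->
  0 < rho_exponent k s <= 1.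
Proof.
move=> /andP[k0 k1] s2; have s1 : 0 < 2 * s + 1 by lra.
rewrite /rho_exponent !max_l; try lra.
have v0 : 0 < (2 * s - 1) / (2 * s + 1) by rewrite divr_gt0 //; lra.
have v1 : (2 * s - 1) / (2 * s + 1) <= 1 by rewrite ler_pdivrMr //; lra.
by rewrite mulr_gt0 ?subr_gt0 // mulr_ile1 ?(ltW v0) //; lra.
Qed.

Lemma ratr_rho_exponent_le (R : realFieldType) (kappa : R) (k s : rat) :
  kappa <= (ratr k : R) < 1 -> 2^-1 < s ->
  exists2 v : R, 0 <= v <= 1 /\ (1 + v) / 2 < ratr s &
    (ratr (rho_exponent k s) : R) <= v * (1 - kappa).
Proof.
move=> /andP[kappak k1] s2; have sR : 2^-1 < ratr s :> R.
  by rewrite -(ratr_nat R 2) -fmorphV ltr_rat.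
pose r : R := ratr s; pose v := (2 * r - 1) / (2 * r + 1).
have s1 : 0 < 2 * r + 1 by rewrite /r; lra.
have v0 : 0 <= v by rewrite divr_ge0 /r //; lra.
exists v; first split; rewrite -/r in sR *.
- by rewrite v0 ler_pdivrMr //; lra.
- rewrite -subr_gt0 (_ : _ - _ = 2 * r * (r - 2^-1) / (2 * r + 1)).
    by rewrite divr_gt0 // mulr_gt0; lra.
  by rewrite /v; field; rewrite lt0r_neq0.
have -> : ratr (rho_exponent k s) = (1 - ratr k) * v.
  have k_le1 : 0 <= 1 - k by rewrite subr_ge0 ltW // -(ltr_rat R) rmorph1.
  rewrite /rho_exponent !max_l //; last lra.
  by rewrite /v /r !(rmorphM, rmorphB, rmorphD, fmorphV, rmorph1, ratr_nat).
by rewrite mulrC ler_wpM2l // lerD2l lerN2.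
Qed.

(** * Real powers *)

Lemma powR_natX (R : realType) (n j : nat) (c : R) :
  (n ^ j)%:R `^ c = (n%:R `^ c) ^+ j.
Proof. by rewrite natrX -powR_mulrn // powRAC powR_mulrn ?powR_ge0. Qed.

Lemma ler_powRl (R : realType) (c x y : R) :
  0 <= c -> 0 <= x <= y -> x `^ c <= y `^ c.
Proof.
move=> c0 /andP[x0 xy]; rewrite ge0_ler_powR ?nnegrE //.
exact: le_trans xy.
Qed.

Lemma le0_ler_powR (R : realType) (c x y : R) :
  c <= 0 -> 0 < x <= y -> y `^ c <= x `^ c.
Proof.
move=> c0 /andP[x0 xy]; have y0 : 0 < y := lt_le_trans x0 xy.
rewrite -[c]opprK !(powRN _ (- c)) lef_pV2 ?posrE ?powR_gt0 //.
by rewrite ler_powRl ?oppr_ge0 // ltW.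
Qed.

(** * The divisor bound *)

Lemma size_divisors (n : nat) :
  size (divisors n) = (\prod_(f <- prime_decomp n) f.2.+1)%N.
Proof.
rewrite /divisors; elim: (prime_decomp n) => [|[p e] s IH] /=.
  by rewrite big_nil.
rewrite big_cons -IH /=; set l := foldr _ _ _.
elim: e => [|e IHe] /=; first by rewrite mul1n.
by rewrite size_merge size_cat size_map IHe -mulSnr.
Qed.

Lemma prod_prime_decomp_powR_le (R : realType) (eps B : R) (P : nat)
    (f : nat -> nat -> R) : 1 <= B ->
  (forall p e, prime p ->
    0 <= f p e <= (if (p < P)%N then B else 1) * (p ^ e)%:R `^ eps) ->
  forall n, (0 < n)%N ->
    \prod_(pe <- prime_decomp n) f pe.1 pe.2 <= B ^+ P * n%:R `^ eps.
Proof.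
move=> B1 fB n n0; set s := prime_decomp n.
have bound_prod : \prod_(pe <- s) f pe.1 pe.2 <=
    (\prod_(pe <- s) if (pe.1 < P)%N then B else 1)
    * \prod_(pe <- s) (pe.1 ^ pe.2)%:R `^ eps.
  rewrite -big_split /= big_seq [leRHS]big_seq; apply: ler_prod => -[p e].
  by move=> /mem_prime_decomp[/fB].
have powR_prod : \prod_(pe <- s) (pe.1 ^ pe.2)%:R `^ eps = n%:R `^ eps.
  rewrite [in RHS](prod_prime_decomp n0) -/s.
  by elim/big_ind2: _ => [|? x ? y -> ->|//]; rewrite ?powR1 // natrM powRM.
apply: le_trans bound_prod _; rewrite powR_prod ler_wpM2r ?powR_ge0 //.
rewrite -big_mkcond big_const_seq iter_mulr_1 ler_weXn2l //.
rewrite -(count_map fst (fun p => p < P)%N) -size_filter -[leqRHS](size_iota 0).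
apply: uniq_leq_size; first by rewrite filter_uniq //; exact: primes_uniq.
by move=> p; rewrite mem_filter mem_iota => /andP[].
Qed.

Lemma natS_le_powR_exp2 (R : realType) (eps : R) (e : nat) : 0 < eps ->
  e.+1%:R <= (1 + (eps * ln 2)^-1) * (2 ^ e)%:R `^ eps.
Proof.
move=> eps0; have c0 : 0 < eps * ln 2 by rewrite mulr_gt0 // ln_gt0 // ltr1n.
have powR_ge : 1 + e%:R * (eps * ln 2) <= (2 ^ e)%:R `^ eps.
  by rewrite powR_natX /powR pnatr_eq0 /= -expRM_natl mulrC; exact: expR_ge1Dx.
apply: le_trans (ler_wpM2l _ powR_ge); last by rewrite addr_ge0 ?invr_ge0 ?ltW.
rewrite mulrDl mul1r mulrDr mulr1 (mulrCA _ e%:R) mulVf ?gt_eqF // mulr1 -natr1.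
have : 0 <= (eps * ln 2)^-1 by rewrite invr_ge0 ltW.
have : 0 <= e%:R * (eps * ln 2) by rewrite mulr_ge0 // ltW.
lra.
Qed.

Lemma size_divisors_le (R : realType) (eps : R) : 0 < eps ->
  exists2 C : R, 0 < C &
    forall n, (0 < n)%N -> (size (divisors n))%:R <= C * n%:R `^ eps.
Proof.
move=> eps0; have eps_ge0 := ltW eps0; pose B : R := 1 + (eps * ln 2)^-1.
have B1 : 1 <= B by rewrite lerDl invr_ge0 mulr_ge0 ?ln_ge0 ?ler1n.
pose P := (Num.truncn ((2 : R) `^ eps^-1)).+1.
have P2 : 2 <= P%:R `^ eps.
  have -> : 2 = ((2 : R) `^ eps^-1) `^ eps.
    by rewrite -powRrM mulVf ?powRr1 // lt0r_neq0.
  by rewrite ler_powRl // powR_ge0 ltW // truncnS_gt.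
exists (B ^+ P) => [|n n0]; first by rewrite exprn_gt0 // (lt_le_trans _ B1).
rewrite size_divisors natr_prod.
apply: (@prod_prime_decomp_powR_le _ eps B P (fun _ e => e.+1%:R)) => //.
move=> p e /prime_gt1 p1; rewrite ler0n /=; case: ltnP => [_|Pp].
  rewrite (le_trans (natS_le_powR_exp2 e eps0)) //.
  rewrite ler_wpM2l ?(le_trans _ B1) //.
  by rewrite ler_powRl // ler0n !natrX lerXn2r ?nnegrE ?ler_nat.
rewrite mul1r powR_natX.
apply: (@le_trans _ _ (2 ^+ e)); first by rewrite -natrX ler_nat ltn_expl.
rewrite lerXn2r ?nnegrE ?powR_ge0 // (le_trans P2) // ler_powRl //.
by rewrite ler0n ler_nat.
Qed.

Lemma sum_multiplesE (V : nmodType) (a : nat -> V) (q N : nat) : (0 < q)%N ->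
  \sum_(1 <= d < (N %/ q).+1) a (d * q)%N
    = \sum_(1 <= m < N.+1 | (q %| m)%N) a m.
Proof.
move=> q0; rewrite -(big_filter _ (fun m => q %| m)%N) /index_iota !subn1 /=.
rewrite -(big_map (fun d => d * q)%N predT a).
apply: perm_big; apply: uniq_perm.
- rewrite map_inj_uniq ?iota_uniq // => x y /eqP.
  by rewrite eqn_pmul2r // => /eqP.
- by rewrite filter_uniq // iota_uniq.
move=> m; rewrite mem_filter mem_iota; apply/mapP/andP => [[d]|].
  rewrite mem_iota => /andP[d1 dN] ->; split; first exact: dvdn_mull.
  by rewrite muln_gt0 d1 q0 /= add1n ltnS -leq_divRL // -ltnS.
case=> /dvdnP[d ->] /andP[m1 mN]; exists d => //; move: m1 mN.
by rewrite muln_gt0 => /andP[d0 _]; rewrite mem_iota d0 !add1n !ltnS -leq_divRL.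
Qed.

Lemma sum_multiples_le_divisors (R : numDomainType) (a : nat -> R) (T N : nat) :
  (forall m, 0 <= a m) ->
  \sum_(1 <= q < T.+1) \sum_(1 <= d < (N %/ q).+1) a (d * q)%N
    <= \sum_(1 <= m < N.+1) (size (divisors m))%:R * a m.
Proof.
move=> a0; rewrite big_nat.
under eq_bigr => q /andP[q0 _] do rewrite sum_multiplesE //.
rewrite -big_nat (exchange_big_dep predT) //=.
rewrite !big_nat; apply: ler_sum => m /andP[m0 _].
rewrite -big_filter big_const_seq count_predT iter_addr_0 -[leLHS]mulr_natl.
rewrite ler_wpM2r // ler_nat; apply: uniq_leq_size.
  by rewrite filter_uniq // iota_uniq.
by move=> q; rewrite mem_filter => /andP[qm _]; rewrite -dvdn_divisors.
Qed.

Lemma sum_pos_multiples_powR_le (R : realType) (a : nat -> R) (A t eps : R) :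
  0 < eps -> (forall m, 0 <= a m) ->
  (forall Q, (1 <= Q)%N -> \sum_(1 <= m < Q.+1) a m <= A * Q%:R `^ t) ->
  exists2 C : R, 0 <= C & forall T N : nat, (0 < N)%N ->
    \sum_(1 <= q < T.+1) \sum_(1 <= d < (N %/ q).+1) a (d * q)%N
      <= C * N%:R `^ (t + eps).
Proof.
move=> eps0 a0 sum_a; have [D D0 size_div] := size_divisors_le eps0.
have A0 : 0 <= A.
  by have := sum_a 1%N isT; rewrite powR1 mulr1 big_nat1; exact: le_trans.
exists (D * A) => [|T N N0]; first by rewrite mulr_ge0 // ltW.
apply: le_trans (sum_multiples_le_divisors T N a0) _.
apply: (@le_trans _ _ (\sum_(1 <= m < N.+1) D * N%:R `^ eps * a m)).
  rewrite !big_nat; apply: ler_sum => m /andP[m0 mN].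
  rewrite ler_wpM2r // (le_trans (size_div _ m0)) // ler_pM2l //.
  by rewrite ler_powRl ?ler0n ?ler_nat // ltW.
rewrite -mulr_sumr (addrC t) powRD ?pnatr_eq0 -?lt0n ?N0 ?implybT //.
by rewrite [leRHS]mulrACA ler_wpM2l ?sum_a // mulr_ge0 ?powR_ge0 // ltW.
Qed.

Lemma sum_multiples_powR_le (R : realType) (a : nat -> R) (A t eps : R) :
  0 < eps -> (forall m, 0 <= a m) ->
  (forall Q, (1 <= Q)%N -> \sum_(0 <= m < Q.+1) a m <= A * Q%:R `^ t) ->
  exists2 C : R, 0 < C & forall T N : nat, (1 <= T <= N)%N ->
    \sum_(1 <= q < T.+1) \sum_(0 <= d < N %/ q) a (d * q)%N
      <= C * (T%:R + N%:R `^ (t + eps)).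
Proof.
move=> eps0 a0 sum_a.
have [Q Q1|C C0 sum_pos] := @sum_pos_multiples_powR_le _ a A t eps eps0 a0.
  by apply: le_trans (sum_a Q Q1); rewrite [leRHS]big_ltn // lerDr.
exists (a 0%N + C + 1) => [|T N /andP[T1 TN]].
  by rewrite ltr_wpDl // addr_ge0.
have split_zero q : (0 < q <= N)%N -> \sum_(0 <= d < N %/ q) a (d * q)%N <=
    a 0%N + \sum_(1 <= d < (N %/ q).+1) a (d * q)%N.
  move=> /andP[q0 qN]; have : (0 < N %/ q)%N by rewrite divn_gt0.
  case: (N %/ q)%N => // M _; rewrite big_ltn // lerD2l.
  by rewrite [leRHS]big_nat_recr //= lerDl.
apply: (@le_trans _ _ (a 0%N * T%:R + C * N%:R `^ (t + eps))).
  apply: le_trans (lerD (lexx _) (sum_pos T N (leq_trans T1 TN))).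
  have -> : a 0%N * T%:R = \sum_(1 <= q < T.+1) a 0%N.
    by rewrite sumr_const_nat subn1 mulr_natr.
  rewrite -big_split /= !big_nat; apply: ler_sum => q /andP[q0 qT].
  by rewrite split_zero // q0 (leq_trans _ TN).
have a00 := a0 0%N; rewrite mulrDr lerD // ler_wpM2r ?powR_ge0 //; lra.
Qed.

(** * Exponential sums *)

Lemma periodic_int (U V : zmodType) (f : U -> V) (T : U) :
  periodic f T -> forall (z : int) (a : U), f (a + T *~ z) = f a.
Proof.
move=> fT [n|n] a; first exact: periodicn.
by rewrite NegzE mulrNz -[LHS](periodicn fT n.+1) subrK.
Qed.

Lemma ler_cos_norm (R : realType) (x y : R) : `|x| <= y <= pi -> cos y <= cos x.
Proof.
move=> /andP[xy ypi].
rewrite -[cos x]cos_norm leNgt ltr_cos -?leNgt // in_itv /=.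
  by rewrite ypi (le_trans _ xy).
by rewrite normr_ge0 (le_trans xy).
Qed.

Section DirichletSquare.
Variable R : realType.
Implicit Types (M : nat) (t : R).

(* The squared modulus of the sum of exp(i m t) over m < M. *)
Definition dirichlet_sqr M t : R :=
  (\sum_(0 <= m < M) cos (m%:R * t)) ^+ 2
  + (\sum_(0 <= m < M) sin (m%:R * t)) ^+ 2.

Lemma dirichlet_sqr_ge0 M t : 0 <= dirichlet_sqr M t.
Proof. by rewrite addr_ge0 // sqr_ge0. Qed.

Lemma dirichlet_sqrE M t : dirichlet_sqr M t =
  \sum_(0 <= m < M) \sum_(0 <= n < M) cos (`|m%:Z - n%:Z|%N%:R * t).
Proof.
rewrite /dirichlet_sqr !expr2 !mulr_suml -big_split /=.
apply: eq_bigr => m _; rewrite !mulr_sumr -big_split /=.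
apply: eq_bigr => n _; rewrite -cosB -mulrBl.
rewrite natr_absz intr_norm rmorphB /=.
have [d0|d0] := leP 0 (m%:R - n%:R : R); first by rewrite ger0_norm.
by rewrite ltr0_norm // mulNr cosN.
Qed.

Lemma dirichlet_sqr_ge M t (c : R) : 0 <= c ->
  (forall m, (m < M)%N -> c <= cos (m%:R * t)) ->
  (c * M%:R) ^+ 2 <= dirichlet_sqr M t.
Proof.
move=> c0 cos_ge.
apply: (@le_trans _ _ ((\sum_(0 <= m < M) cos (m%:R * t)) ^+ 2)).
  have cM : c * M%:R <= \sum_(0 <= m < M) cos (m%:R * t).
    rewrite mulr_natr -[X in c *+ X]subn0 -sumr_const_nat !big_nat.
    by apply: ler_sum => m /andP[_ /cos_ge].
  by rewrite lerXn2r ?nnegrE ?(le_trans _ cM) // mulr_ge0.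
by rewrite lerDl sqr_ge0.
Qed.

Lemma measurable_dirichlet_sqr M : measurable_fun setT (dirichlet_sqr M).
Proof.
have measurable_trig_sum (f : R -> R) : continuous f ->
    measurable_fun setT (fun t => \sum_(0 <= m < M) f (m%:R * t)).
  move=> cf; apply: measurable_sum => m; apply: continuous_measurable_fun => t.
  by apply: (@continuous_comp _ _ _ (fun t => m%:R * t) f);
    [exact: mulrl_continuous | exact: cf].
by apply: measurable_funD; apply: measurable_funX; apply: measurable_trig_sum;
  [exact: continuous_cos | exact: continuous_sin].
Qed.

End DirichletSquare.

Lemma sum_distn_le (R : numDomainType) (b : nat -> R) (M : nat) :
  (forall d, 0 <= b d) ->
  \sum_(0 <= m < M) \sum_(0 <= n < M) b `|m%:Z - n%:Z|%N
    <= 2 * M%:R * \sum_(0 <= d < M) b d.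
Proof.
move=> b0; set S := \sum_(0 <= d < M) b d.
have sum_prefix k : (k <= M)%N -> \sum_(0 <= d < k) b d <= S.
  by move=> kM; rewrite [leRHS](big_cat_nat (n := k)) //= lerDl sumr_ge0.
suff row_le m : (m < M)%N -> \sum_(0 <= n < M) b `|m%:Z - n%:Z|%N <= 2 * S.
  apply: (@le_trans _ _ (\sum_(0 <= m < M) 2 * S)).
    by rewrite !big_nat; apply: ler_sum => m /andP[_ /row_le].
  by rewrite sumr_const_nat subn0 -[leLHS]mulr_natl mulrCA mulrA.
move=> mM; rewrite (big_cat_nat (n := m.+1)) //= mulr_natl mulr2n lerD //.
  rewrite big_nat_rev /= big_nat (eq_bigr b) -?big_nat ?sum_prefix //.
  by move=> n /andP[_ nm]; congr b; lia.
apply: (@le_trans _ _ (\sum_(0 <= d < (M - m.+1).+1) b d)).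
  rewrite -[m.+1]add0n big_addn [leRHS]big_nat_recl //.
  rewrite (eq_bigr (fun d => b d.+1)); first by rewrite lerDr.
  by move=> d _; congr b; lia.
by apply: sum_prefix; lia.
Qed.

Lemma integrable_cos (R : realType)
    (mu : {finite_measure set (measurableTypeR R) -> \bar R}) (c : R) :
  mu.-integrable setT (EFin \o (fun x => cos (c * x))).
Proof.
apply: measurable_bounded_integrable => //.
- exact: fin_num_fun_lty.
- apply: continuous_measurable_fun => x.
  apply: (@continuous_comp _ _ _ (fun x => c * x) cos).
    exact: mulrl_continuous.
  exact: continuous_cos.
- exists 1; split => // e e1 x _; apply: le_trans (ltW e1).
  by rewrite ler_norml cos_geN1 cos_le1.
Qed.

(** * Measure estimates *)

Lemma markov_ge0 d (T : measurableType d) (R : realType)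
    (mu : {measure set T -> \bar R}) (f : T -> R) (c : R) :
  measurable_fun setT f -> (forall x, 0 <= f x) -> 0 < c ->
  (c%:E * mu [set x | (c <= f x)%R] <= \int[mu]_x (f x)%:E)%E.
Proof.
move=> mf f0 c0; have absf x : `|(f x)%:E|%E = (f x)%:E.
  by rewrite gee0_abs ?lee_fin.
have -> : [set x | c <= f x] = setT `&` [set x | (c%:E <= `|(f x)%:E|)%E].
  by rewrite setTI; apply: eq_set => x; rewrite absf lee_fin.
under eq_integral do rewrite -absf.
apply: (@le_integral_comp_abse _ _ _ mu _ measurableT (EFin \o f) c id) => //.
exact/measurable_EFinP.
Qed.

Lemma counting_le (T : choiceType) (R : realType) (A : set T) (M : R) :
  (forall F : {fset T}, [set` F] `<=` A -> #|` F|%:R <= M) ->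
  (counting A <= M%:E)%E.
Proof.
move=> card_le; have finA : finite_set A.
  apply: contrapT => /(infinite_set_fset (Num.truncn M).+1)[F FA truncF].
  have := le_lt_trans (card_le F FA) (truncnS_gt M).
  by rewrite ltr_nat ltnNge truncF.
by rewrite /counting asboolT // lee_fin card_le // fset_setK.
Qed.

Lemma counting_finite (T : choiceType) (R : realType) (A : set T) (M : R) :
  (counting A <= M%:E)%E -> finite_set A.
Proof. by rewrite /counting; case: asboolP. Qed.

Section CountingMeasureEstimates.
Context d (X : measurableType d) (R : realType).
Variable mu : {measure set X -> \bar R}.
Variables (T : choiceType) (A : set T) (B : T -> set X).
Hypothesis mB : forall y, measurable (B y).

Lemma counting_packing_le (U : set X) (c M : R) :
  0 < c -> trivIset A B -> (forall y, A y -> (c%:E <= mu (B y))%E) ->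
  measurable U -> \bigcup_(y in A) B y `<=` U -> (mu U <= M%:E)%E ->
  (counting A <= (M / c)%:E)%E.
Proof.
move=> c0 tB cB mU BU UM; apply: counting_le => F FA.
rewrite ler_pdivlMr // -lee_fin (le_trans _ UM) //.
apply: (@le_trans _ _ (\sum_(y <- F) mu (B y))%E).
  rewrite mulr_natl -[#|` F|]/(size F) -count_predT -iter_addr_0 -big_const_seq.
  rewrite -sumEFin big_seq [leRHS]big_seq.
  by apply: lee_sum => y yF; apply: cB; exact: FA.
rewrite -measure_fbigsetU //; last exact: sub_trivIset tB.
apply: le_measure; [|exact: mem_set|].
  by apply: mem_set; exact: bigsetU_measurable.
by rewrite -bigcup_fset; apply: subset_trans BU; exact: bigcup_subset.
Qed.

Lemma measure_bigcup_counting_le (c M : R) :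
  0 <= c -> (forall y, A y -> (mu (B y) <= c%:E)%E) -> (counting A <= M%:E)%E ->
  (mu (\bigcup_(y in A) B y) <= (M * c)%:E)%E.
Proof.
move=> c0 Bc AM; have finA := counting_finite AM.
apply: (@le_trans _ _ (\sum_(y \in A) mu (B y))%E).
  by apply: content_sub_fsum => //; exact: fin_bigcup_measurable.
rewrite fsbig_finite //=.
apply: (@le_trans _ _ (\sum_(y <- fset_set A) c%:E)%E).
  rewrite big_seq [leRHS]big_seq; apply: lee_sum => y.
  by rewrite in_fset_set // => /set_mem; exact: Bc.
rewrite sumEFin lee_fin big_const_seq count_predT iter_addr_0 -[leLHS]mulr_natl.
by rewrite ler_wpM2r //; move: AM; rewrite /counting asboolT.
Qed.

End CountingMeasureEstimates.

Lemma measurable_lim_sup_set d (T : measurableType d) (E : (set T)^nat) :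
  (forall n, measurable (E n)) -> measurable (lim_sup_set E).
Proof.
move=> mE; apply: bigcapT_measurable => n.
by apply: bigcup_measurable => j _; exact: mE.
Qed.

Lemma lim_sup_set_geometric0 d (T : measurableType d) (R : realType)
    (mu : {measure set T -> \bar R}) (E : (set T)^nat) (D z : R) :
  (forall n, measurable (E n)) -> 0 <= D -> 0 < z < 1 ->
  (forall n, (mu (E n) <= (D * z ^+ n)%:E)%E) -> mu (lim_sup_set E) = 0%E.
Proof.
move=> mE D0 /andP[z0 z1] muE; apply: lim_sup_set_cvg0 => //.
apply: (@le_lt_trans _ _ (D * (1 - z)^-1)%:E); last exact: ltry.
apply: lime_le; first exact: is_cvg_nneseries.
apply: nearW => n; apply: (@le_trans _ _ (\sum_(0 <= j < n) (D * z ^+ j)%:E)%E).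
  by apply: lee_sum => j _; exact: muE.
rewrite sumEFin lee_fin; apply: geometric_le_lim => //.
by rewrite gtr0_norm.
Qed.

Lemma trivIset_ball (R : realFieldType) (V : normedModType R) (A : set V)
    (r : R) :
  (forall x y, A x -> A y -> x != y -> 2 * r <= `|x - y|) ->
  trivIset A (fun x => ball x r).
Proof.
move=> sepA x y Ax Ay [z []]; rewrite -!ball_normE /= => xz yz.
apply/eqP; apply: contraT => /(sepA x y Ax Ay); rewrite leNgt => /negP; case.
by rewrite (le_lt_trans (ler_distD z _ _)) // mulr_natl mulr2n ltrD // distrC.
Qed.

(** * Resonance sets *)

Definition resonance_set {R : realType} (M q : nat) : set R :=
  [set x | (cos 1 * M%:R) ^+ 2 <= dirichlet_sqr M (2 * pi * q%:R * x)].

Lemma measurable_dirichlet_sqr_scale (R : realType) (M : nat) (c : R) :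
  measurable_fun setT (fun x : R => dirichlet_sqr M (c * x)).
Proof.
apply: (measurableT_comp (measurable_dirichlet_sqr M)).
exact: measurable_funM.
Qed.

Lemma measurable_resonance_set (R : realType) (M q : nat) :
  measurable (resonance_set M q : set R).
Proof.
rewrite (_ : resonance_set M q = setT `&`
    (fun x => dirichlet_sqr M (2 * pi * q%:R * x))
      @^-1` `[(cos 1 * M%:R) ^+ 2, +oo[); last first.
  rewrite setTI; apply/seteqP.
  by split => x; rewrite /resonance_set /= in_itv /= andbT.
by apply: measurable_dirichlet_sqr_scale => //; exact: measurable_itv.
Qed.

Lemma ball_sub_resonance_set (R : realType) (M q : nat) (x r : R) :
  q%:R * x \is a Num.int -> 2 * pi * (M * q)%:R * r <= 1 ->
  ball x r `<=` resonance_set M q.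
Proof.
move=> /intrP[p qx] small y; rewrite -ball_normE /= => xy.
apply: dirichlet_sqr_ge => [|m mM]; first exact: ltW (cos1_gt0 R).
have -> : m%:R * (2 * pi * q%:R * y)
    = 2 * pi * (m * q)%:R * (y - x) + pi *+ 2 *~ (m%:Z * p).
  rewrite -(mulrzl (pi *+ 2)) intrM /= -qx natrM -[pi *+ 2]mulr_natl -pmulrn.
  by ring.
rewrite periodic_int ?ler_cos_norm //; last exact: cosD2pi.
have pi2 := pi_ge2 R; rewrite (_ : 1 <= pi) ?andbT; last lra.
rewrite normrM ger0_norm ?mulr_ge0 ?pi_ge0 // (le_trans _ small) //.
apply: ler_pM; rewrite ?normr_ge0 ?mulr_ge0 ?pi_ge0 //.
  by rewrite ler_wpM2l ?mulr_ge0 ?pi_ge0 // ler_nat leq_mul2r ltnW ?orbT.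
by rewrite distrC ltW.
Qed.

Section FourierBounds.
Variables (R : realType) (nu : probability (measurableTypeR R) R).

Definition fourier_abs (m : nat) : R :=
  ComplexField.Normc.normc (fourier_coef nu m%:Z).

Lemma fourier_abs_ge0 m : 0 <= fourier_abs m.
Proof.
by rewrite /fourier_abs; case: fourier_coef => a b; exact: sqrtr_ge0.
Qed.

Lemma integral_cos_le m :
  (\int[nu]_x (cos (2 * pi * m%:R * x))%:E <= (fourier_abs m)%:E)%E.
Proof.
rewrite -[leLHS]fineK; last first.
  by apply: integrable_fin_num => //; exact: integrable_cos.
rewrite lee_fin /fourier_abs /fourier_coef /complex_integral /e2pii /=.
have -> : fine (\int[nu]_x (cos (2 * pi * m%:R * x))%:E)
    = \int[nu]_x cos (2 * pi * - (m%:R * x)).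
  by apply: eq_Rintegral => x _; rewrite mulrN cosN mulrA.
by rewrite (le_trans (ler_norm _)) // -sqrtr_sqr ler_wsqrtr // lerDl sqr_ge0.
Qed.

Lemma integral_dirichlet_sqr_le M q :
  (\int[nu]_x (dirichlet_sqr M (2 * pi * q%:R * x))%:E
    <= (2 * M%:R * \sum_(0 <= d < M) fourier_abs (d * q))%:E)%E.
Proof.
pose dist (mn : nat * nat) := `|mn.1%:Z - mn.2%:Z|%N.
pose pairs := [seq (m, n) | m <- index_iota 0 M, n <- index_iota 0 M].
have -> : (\int[nu]_x (dirichlet_sqr M (2 * pi * q%:R * x))%:E =
    \int[nu]_x \sum_(mn <- pairs) (cos (2 * pi * (dist mn * q)%:R * x))%:E)%E.
  apply: eq_integral => x _; rewrite dirichlet_sqrE sumEFin big_allpairs.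
  congr EFin; apply: eq_bigr => m _; apply: eq_bigr => n _; congr cos.
  by rewrite natrM /dist /=; ring.
rewrite integral_sum //; last by move=> mn; exact: integrable_cos.
apply: (@le_trans _ _ (\sum_(mn <- pairs) (fourier_abs (dist mn * q))%:E)%E).
  by apply: lee_sum => mn _; exact: integral_cos_le.
rewrite sumEFin lee_fin big_allpairs.
by apply: (sum_distn_le M (fun d => fourier_abs_ge0 (d * q))).
Qed.

Lemma measure_resonance_set_le M q : (0 < M)%N ->
  (nu (resonance_set M q)
    <= (2 / (cos 1 ^+ 2 * M%:R) * \sum_(0 <= d < M) fourier_abs (d * q))%:E)%E.
Proof.
move=> M0; have c1 : 0 < cos 1 :> R := cos1_gt0 R.
have MR : 0 < M%:R :> R by rewrite ltr0n.
have level_gt0 : 0 < (cos 1 * M%:R) ^+ 2 :> R by rewrite exprn_gt0 // mulr_gt0.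
have := markov_ge0 nu (measurable_dirichlet_sqr_scale M _)
  (fun x => dirichlet_sqr_ge0 M (2 * pi * q%:R * x)) level_gt0.
move=> /le_trans /(_ (integral_dirichlet_sqr_le M q)).
rewrite -lee_pdivlMl // => /le_trans; apply; rewrite -EFinM lee_fin mulrA.
rewrite ler_wpM2r ?sumr_ge0 // => [d _|]; first exact: fourier_abs_ge0.
by rewrite le_eqVlt; apply/orP; left; apply/eqP; field; rewrite !lt0r_neq0.
Qed.

Definition multiples_fourier_sum (T N : nat) : R :=
  \sum_(1 <= q < T.+1) \sum_(0 <= d < N %/ q) fourier_abs (d * q).

Lemma multiples_fourier_sum_ge0 T N : 0 <= multiples_fourier_sum T N.
Proof. by do 2![apply: sumr_ge0 => ? _]; exact: fourier_abs_ge0. Qed.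

Lemma measure_bigcup_resonance_set_le T N : (T <= N)%N ->
  (nu (\bigcup_(q < T) resonance_set (N %/ q.+1) q.+1)
    <= (4 / cos 1 ^+ 2 * (T%:R / N%:R) * multiples_fourier_sum T N)%:E)%E.
Proof.
move=> TN; have c1 : 0 < cos 1 :> R := cos1_gt0 R.
pose A q : set (measurableTypeR R) := resonance_set (N %/ q.+1) q.+1.
rewrite bigcup_mkord; apply: le_trans (@Boole_inequality _ _ _ nu A T _) _.
  by move=> q _; exact: measurable_resonance_set.
rewrite -(big_mkord predT (fun q => nu (A q))).
rewrite /multiples_fourier_sum big_add1 /= mulr_sumr -sumEFin !big_nat.
apply: lee_sum => q /andP[_ qT]; have qN : (q < N)%N := leq_trans qT TN.
have M0 : (0 < N %/ q.+1)%N by rewrite divn_gt0.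
apply: le_trans (measure_resonance_set_le q.+1 M0) _; rewrite lee_fin.
rewrite ler_wpM2r ?sumr_ge0 // => [d _|]; first exact: fourier_abs_ge0.
have MR : 0 < (N %/ q.+1)%:R :> R by rewrite ltr0n.
have NR : 0 < N%:R :> R by rewrite ltr0n (leq_trans _ qN).
rewrite [leRHS](_ : _ = 2 / cos 1 ^+ 2 * (2 * T%:R / N%:R)); last by ring.
rewrite [leLHS](_ : _ = 2 / cos 1 ^+ 2 * (N %/ q.+1)%:R^-1); last first.
  by rewrite invfM mulrA.
rewrite ler_wpM2l ?divr_ge0 ?sqr_ge0 //.
rewrite -[leLHS]mul1r ler_pdivrMr // mulrAC ler_pdivlMr // mul1r.
rewrite -!natrM ler_nat.
have := ltn_ceil N (ltn0Sn q); nia.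
Qed.

Lemma multiples_fourier_sum_le (t : R) : ((1 - t)%:E < fourier_l1_dim nu)%E ->
  exists2 C : R, 0 < C & forall T N : nat, (1 <= T <= N)%N ->
    multiples_fourier_sum T N <= C * (T%:R + N%:R `^ t).
Proof.
move=> /ereal_sup_gt[_ [s [_ [A sum_le]] <-]]; rewrite lte_fin => ts.
have eps0 : 0 < t - (1 - s) by lra.
have [C C0 CP] := sum_multiples_powR_le eps0 fourier_abs_ge0 sum_le.
exists C => // T N TN; rewrite (le_trans (CP T N TN)) //.
by rewrite (addrC (1 - s)) subrK.
Qed.

End FourierBounds.

(** * Counting rational points *)

Lemma leq_sqrn (n : nat) : (n <= n ^ 2)%N.
Proof. by case: n => // n; rewrite -{1}[n.+1]expn1 leq_pexp2l. Qed.

Definition low_denominator (R : realType) (K : set R) (T : nat) : set R :=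
  [set x : R | K x /\
    exists q : nat, (1 <= q <= T)%N /\ q%:R * x \is a Num.int].

Lemma low_denominator_separated (R : realType) (K : set R) (T : nat) (x y : R) :
  low_denominator K T x -> low_denominator K T y -> x != y ->
  1 <= T%:R ^+ 2 * `|x - y|.
Proof.
move=> [_ [q [/andP[q0 qT] xi]]] [_ [r [/andP[r0 rT] yi]]] xy.
have qr_int : q%:R * r%:R * (x - y) \is a Num.int.
  rewrite mulrBr rpredB //; last by rewrite -mulrA rpredM // natr_int.
  by rewrite mulrAC rpredM // natr_int.
have := norm_intr_ge1 qr_int; rewrite !mulf_neq0 ?pnatr_eq0 -?lt0n ?subr_eq0 //.
move=> /(_ isT) /le_trans; apply.
by rewrite normrM ler_wpM2r // normrM !normr_nat expr2 ler_pM // ler_nat.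
Qed.

Definition regular_on (R : realType) (nu : set R -> \bar R) (A kappa : R)
    (K : set R) : Prop :=
  forall x r : R, K x -> 0 < r <= 1 ->
    ((A^-1 * r `^ kappa)%:E <= nu (ball x r) <= (A * r `^ kappa)%:E)%E.

Lemma AD_regular_on_supp (R : realType) (kappa : R)
    (nu : probability (measurableTypeR R) R) :
  0 <= kappa -> AD_regular kappa nu ->
  exists2 A : R, 0 < A & regular_on nu A kappa (supp nu).
Proof.
move=> kappa0 [A [r0 [A1 r00 nuA]]]; have A0 : 0 < A := lt_trans ltr01 A1.
pose delta := Num.min (r0 / 2) 1; have d0 : 0 < delta.
  by rewrite lt_min ltr01 divr_gt0.
have dr0 : delta < r0.
  by rewrite gt_min ltr_pdivrMr // ltr_pMr // ltr1n.
have powR_le1 (x : R) : 0 <= x <= 1 -> x `^ kappa <= 1.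
  by move=> /(ler_powRl kappa0); rewrite powR1.
have p0 : 0 < delta `^ kappa by rewrite powR_gt0.
have p1 : delta `^ kappa <= 1 by rewrite powR_le1 // (ltW d0) ge_min lexx orbT.
have AAd : A <= A / delta `^ kappa by rewrite ler_pdivlMr // ger_pMr.
exists (A / delta `^ kappa) => [|x r Kx /andP[rpos r1]].
  by rewrite divr_gt0.
have [rd|dr] := leP r delta.
  have /(nuA x _ Kx)/andP[lo hi] : 0 < r < r0 by rewrite rpos (le_lt_trans rd).
  rewrite (le_trans _ lo) ?(le_trans hi) // lee_fin ler_wpM2r ?powR_ge0 //.
  by rewrite lef_pV2 ?posrE ?divr_gt0.
apply/andP; split; last first.
  apply: le_trans (probability_le1 nu (measurable_ball x r)) _.
  rewrite lee_fin mulrAC -mulrA (le_trans (ltW A1)) // ler_peMr ?(ltW A0) //.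
  by rewrite ler_pdivlMr // mul1r ler_powRl // !ltW.
have /(nuA x _ Kx)/andP[lo _] : 0 < delta < r0 by rewrite d0.
apply: (@le_trans _ _ (A^-1 * delta `^ kappa)%:E).
  rewrite lee_fin invfM invrK -mulrA ler_wpM2l ?invr_ge0 ?(ltW A0) //.
  by rewrite ger_pMr // powR_le1 // (ltW rpos).
apply: (le_trans lo); apply: le_measure; last exact: le_ball (ltW dr).
- by apply: mem_set; exact: measurable_ball.
- by apply: mem_set; exact: measurable_ball.
Qed.

Lemma rational_count_le_fourier_sum (R : realType)
    (nu : probability (measurableTypeR R) R) (A kappa : R) (K : set R)
    (T N : nat) :
  0 < A -> regular_on nu A kappa K -> (1 <= T)%N -> (T ^ 2 <= N)%N ->
  (rational_count K T <= (4 * 8 `^ kappa * A / cos 1 ^+ 2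
    * (T%:R * N%:R `^ (kappa - 1) * multiples_fourier_sum nu T N))%:E)%E.
Proof.
move=> A0 regA T1 TN; have c1 : 0 < cos 1 :> R := cos1_gt0 R.
have TleN : (T <= N)%N := leq_trans (leq_sqrn T) TN.
have N1 : (1 <= N)%N := leq_trans T1 TleN.
have N0 : 0 < N%:R :> R by rewrite ltr0n.
pose r : R := (8 * N%:R)^-1; have r0 : 0 < r by rewrite invr_gt0 mulr_gt0.
have r1 : r <= 1 by rewrite invf_le1 ?mulr_gt0 // -natrM ler1n muln_gt0.
pose c := A^-1 * r `^ kappa.
have c0 : 0 < c by rewrite mulr_gt0 ?invr_gt0 ?powR_gt0.
have mass_cover := measure_bigcup_resonance_set_le nu TleN.
have -> : 4 * 8 `^ kappa * A / cos 1 ^+ 2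
    * (T%:R * N%:R `^ (kappa - 1) * multiples_fourier_sum nu T N)
    = 4 / cos 1 ^+ 2 * (T%:R / N%:R) * multiples_fourier_sum nu T N / c.
  have -> : c = A^-1 * (8 `^ kappa * N%:R `^ kappa)^-1.
    rewrite /c /r -powRM ?(ltW N0) //; congr (_ * _).
    by rewrite -!powR_inv1 ?powR_ge0 ?mulr_ge0 ?(ltW N0) // powRAC.
  rewrite powRB ?lt0r_neq0 ?implybT // powRr1 ?(ltW N0) //.
  by field; rewrite !lt0r_neq0 ?powR_gt0.
apply: (counting_packing_le (mu := nu) (B := ball^~ r)) mass_cover => //.
- by move=> x; exact: measurable_ball.
- apply: trivIset_ball => x y Kx Ky xy.
  rewrite ler_pdivrMr ?mulr_gt0 //.
  have := low_denominator_separated Kx Ky xy; have : T%:R ^+ 2 <= N%:R :> R.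
    by rewrite -natrX ler_nat.
  by have := normr_ge0 (x - y); nra.
- move=> x [Kx _].
  by have /(regA x _ Kx)/andP[] : 0 < r <= 1 by rewrite r0.
- by apply: bigcup_measurable => q _; exact: measurable_resonance_set.
move=> z [x [_ [q [/andP[q1 qT] qx]]] xz].
exists q.-1; rewrite /= prednK //; apply: ball_sub_resonance_set xz => //.
rewrite ler_pdivrMr ?mulr_gt0 // mul1r.
have : (N %/ q * q)%:R <= N%:R :> R by rewrite ler_nat leq_divM.
have := pihalf_lt2 R; have := pi_gt0 R; nra.
Qed.

Lemma powR_scale (R : realType) (kappa v : R) (T : nat) :
  kappa <= 1 -> 0 <= v <= 1 -> (1 <= T)%N ->
  exists N : nat, [/\ (T ^ 2 <= N)%N, N%:R `^ ((1 - v) / 2) <= 2 * T%:R &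
    N%:R `^ (kappa - 1) <= T%:R `^ ((2 + v) * (kappa - 1))].
Proof.
move=> kappa1 /andP[v0 v1] T1; have TR : 1 <= T%:R :> R by rewrite ler1n.
have T0 : 0 < T%:R :> R := lt_le_trans ltr01 TR.
pose X : R := T%:R `^ (2 + v); have T2X : T%:R ^+ 2 <= X.
  by rewrite -powR_mulrn ?(ltW T0) // ler_powR // lerDl.
have X1 : 1 <= X by rewrite (le_trans _ T2X) // exprn_ege1.
have X0 : 0 < X := lt_le_trans ltr01 X1.
pose N := (Num.truncn X).+1; have XN : X <= N%:R := ltW (truncnS_gt X).
have N2X : N%:R <= 2 * X.
  have /andP[truncX _] := truncn_itv (ltW X0).
  by rewrite /N -natr1; lra.
exists N; split.
- by rewrite -(ler_nat R) natrX (le_trans T2X).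
- apply: (@le_trans _ _ ((2 * X) `^ ((1 - v) / 2))).
    by rewrite ler_powRl ?ler0n //; lra.
  rewrite powRM ?(ltW X0) // ler_pM ?powR_ge0 //.
    by rewrite ler1_powR ?ler1n //; lra.
  by rewrite -powRrM -[leRHS]powRr1 ?(ltW T0) // ler_powR //; nra.
- by rewrite powRrM le0_ler_powR ?X0 // subr_le0.
Qed.

Lemma rational_count_powR_le (R : realType)
    (nu : probability (measurableTypeR R) R) (A kappa v : R) (K : set R) :
  0 < A -> regular_on nu A kappa K -> kappa <= 1 -> 0 <= v <= 1 ->
  (((1 + v) / 2)%:E < fourier_l1_dim nu)%E ->
  exists2 C : R, 0 < C & forall T : nat, (1 <= T)%N ->
    (rational_count K T <= (C * T%:R `^ (2 * kappa - v * (1 - kappa)))%:E)%E.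
Proof.
move=> A0 regA kappa1 v01 dim_gt; pose t := (1 - v) / 2.
have [|D D0 fourier_le] := @multiples_fourier_sum_le _ nu t.
  by rewrite (_ : 1 - t = (1 + v) / 2) // /t; field.
pose B := 4 * 8 `^ kappa * A / cos 1 ^+ 2; have B0 : 0 < B.
  by rewrite divr_gt0 ?exprn_gt0 ?cos1_gt0 // !mulr_gt0 ?powR_gt0.
exists (B * (D * 3)) => [|T T1]; first by rewrite pmulr_rgt0 // mulr_gt0.
have [N [T2N Nt Nkappa]] := powR_scale kappa1 v01 T1.
have TN : (1 <= T <= N)%N by rewrite T1 (leq_trans (leq_sqrn T)).
have T0 : 0 < T%:R :> R by rewrite ltr0n.
apply: le_trans (rational_count_le_fourier_sum A0 regA T1 T2N) _.
rewrite lee_fin -/B -[leRHS]mulrA ler_pM2l //.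
have -> : T%:R `^ (2 * kappa - v * (1 - kappa))
    = T%:R ^+ 2 * T%:R `^ ((2 + v) * (kappa - 1)).
  rewrite -powR_mulrn ?(ltW T0) // -powRD ?lt0r_neq0 ?implybT //.
  by congr (_ `^ _); ring.
have -> : D * 3 * (T%:R ^+ 2 * T%:R `^ ((2 + v) * (kappa - 1)))
    = T%:R * T%:R `^ ((2 + v) * (kappa - 1)) * (D * (T%:R + 2 * T%:R)) by ring.
apply: ler_pM; first by rewrite mulr_ge0 ?powR_ge0.
- exact: multiples_fourier_sum_ge0.
- by rewrite ler_wpM2l.
by rewrite (le_trans (fourier_le T N TN)) // ler_pM2l // lerD2l.
Qed.

(** * Intrinsic approximation *)

Lemma finite_absz_lt (m : nat) : finite_set [set p : int | (`|p| < m)%N].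
Proof.
apply: (@sub_finite_set _ _ ((Posz @` `I_m) `|` (Negz @` `I_m))).
  case=> n /= nm; [by left; exists n | right; exists n => //].
  exact: ltnW.
by rewrite finite_setU; split; apply: finite_image; exact: finite_II.
Qed.

Lemma finite_set_nat_ub (A : set nat) :
  finite_set A -> exists n, forall m, A m -> (m < n)%N.
Proof.
move=> finA; exists (\max_(m <- fset_set A) m).+1 => m Am; rewrite ltnS.
by apply: (@leq_bigmax_seq _ _ predT id) => //; rewrite in_fset_set ?mem_set.
Qed.

Lemma absz_lt_of_near (R : realType) (x : R) (p : int) (q n : nat) :
  (0 < q < n)%N -> `|x - p%:~R / q%:R| < 1 ->
  (`|p| < n * (Num.truncn (`|x| + 1)).+1)%N.
Proof.
move=> /andP[q0 qn] near; have qR : 0 < q%:R :> R by rewrite ltr0n.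
have : `|p%:~R / q%:R| < `|x| + 1 :> R.
  by rewrite -[p%:~R / q%:R](subKr x) (le_lt_trans (ler_normB _ _)) // ltrD2l.
rewrite -(ltr_nat R) natr_absz intr_norm natrM normrM normfV normr_nat.
rewrite ltr_pdivrMr // => /lt_le_trans; apply; rewrite mulrC.
by rewrite ler_pM ?addr_ge0 ?ler_nat ?(ltnW qn) // ltW // truncnS_gt.
Qed.

Section WSet.
Variables (R : realType) (K : set R) (alpha : R).
Hypothesis alpha_ge0 : 0 <= alpha.

Definition denominator_nbhd (q : nat) : set R :=
  \bigcup_(p in [set p : int | (0 < q)%N /\ K (p%:~R / q%:R)])
    ball (p%:~R / q%:R : R) (q%:R `^ (- alpha)).

Lemma measurable_denominator_nbhd q : measurable (denominator_nbhd q).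
Proof.
rewrite /denominator_nbhd bigcup_mkcond.
apply: countable_bigcupT_measurable => // p.
by case: ifP => _ //; exact: measurable_ball.
Qed.

Lemma powRN_nat_le1 q : (0 < q)%N -> q%:R `^ (- alpha) <= 1 :> R.
Proof.
by move=> q0; rewrite -[leRHS](powRr0 q%:R) ler_powR ?ler1n ?oppr_le0.
Qed.

Lemma W_setE : W_set K alpha = lim_sup_set denominator_nbhd.
Proof.
apply/seteqP; split => x.
- move=> Wx n _; apply: contrapT => not_near; apply: Wx.
  pose m := (n * (Num.truncn (`|x| + 1)).+1)%N.
  apply: (@sub_finite_set _ _ ([set p : int | (`|p| < m)%N] `*` `I_n));
    last first.
    by apply: finite_setX; [exact: finite_absz_lt | exact: finite_II].
  move=> [p q] /= [q0 Kpq xpq]; have qn : (q < n)%N.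
    rewrite ltnNge; apply/negP => nq; apply: not_near.
    by exists q => //; exists p => //; rewrite -ball_normE /= distrC.
  split => //=; apply: (@absz_lt_of_near _ _ _ q); first by rewrite q0.
  by rewrite (lt_le_trans xpq) ?powRN_nat_le1.
- move=> Ex /(finite_image snd)/finite_set_nat_ub[n q_lt].
  have [q /= nq [p [q0 Kpq]]] := Ex n I.
  rewrite -ball_normE /= distrC => xpq.
  have := q_lt q; rewrite ltnNge nq => /(_ _)/negP; case=> //.
  by exists (p, q).
Qed.

Lemma measurable_W_set : measurable (W_set K alpha).
Proof.
by rewrite W_setE; exact: measurable_lim_sup_set measurable_denominator_nbhd.
Qed.

Lemma W_set_dyadic : W_set K alpha `<=` lim_sup_set (fun j =>
  \bigcup_(y in low_denominator K (2 ^ j.+1)) ball y ((2 ^ j)%:R `^ (- alpha))).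
Proof.
rewrite W_setE => x Ex n _; have [q /= nq [p [q0 Kpq] xpq]] := Ex (2 ^ n)%N I.
have /andP[jq qj] := trunc_log_bounds (isT : 1 < 2)%N q0.
exists (trunc_log 2 q); first by rewrite /= trunc_log_max.
exists (p%:~R / q%:R).
  split => //; exists q; split; first by rewrite q0 ltnW.
  by rewrite mulrC divfK ?intr_int // pnatr_eq0 -lt0n.
apply: le_ball xpq.
by rewrite le0_ler_powR ?oppr_le0 // ltr0n expn_gt0 ler_nat.
Qed.

End WSet.

Lemma measure_W_set_eq0 (R : realType)
    (nu : {measure set (measurableTypeR R) -> \bar R})
    (A kappa C b alpha : R) (K : set R) :
  0 <= A -> regular_on nu A kappa K ->
  0 <= alpha -> b < alpha * kappa -> 0 <= C ->
  (forall T : nat, (1 <= T)%N ->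
    (rational_count K T <= (C * T%:R `^ b)%:E)%E) ->
  nu (W_set K alpha) = 0%E.
Proof.
move=> A0 regA alpha0 b_lt C0 countC.
pose r j : R := (2 ^ j)%:R `^ (- alpha).
pose E j := \bigcup_(y in low_denominator K (2 ^ j.+1)) ball y (r j).
have mE j : measurable (E j : set (measurableTypeR R)).
  apply: fin_bigcup_measurable; last by move=> y _; exact: measurable_ball.
  by apply: counting_finite (countC (2 ^ j.+1)%N _); rewrite expn_gt0.
pose z : R := 2 `^ (b - alpha * kappa).
have z01 : 0 < z < 1.
  rewrite powR_gt0 // /z -opprB powRN invf_lt1 ?powR_gt0 //.
  have ab0 : 0 < alpha * kappa - b by rewrite subr_gt0.
  have := gt0_ltr_powR ab0 (ler01 : 1 \in Num.nneg) (ler0n R 2).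
  by rewrite powR1 ltr1n => ->.
have nuE j : (nu (E j) <= (C * A * 2 `^ b * z ^+ j)%:E)%E.
  have r01 : 0 < r j <= 1.
    by rewrite powR_gt0 ?powRN_nat_le1 ?ltr0n ?expn_gt0.
  have -> : C * A * 2 `^ b * z ^+ j
      = C * (2 ^ j.+1)%:R `^ b * (A * r j `^ kappa).
    rewrite -powR_natX expnS natrM powRM // /r -powRrM mulNr powRD.
      by ring.
    by rewrite pnatr_eq0 expn_eq0 implybT.
  apply: measure_bigcup_counting_le.
  - by move=> y; exact: measurable_ball.
  - by rewrite mulr_ge0 ?powR_ge0.
  - by move=> y [Ky _]; have /andP[] := regA y (r j) Ky r01.
  - by apply: countC; rewrite expn_gt0.
apply/eqP; rewrite eq_le measure_ge0 andbT.
rewrite -(lim_sup_set_geometric0 mE _ z01 nuE) ?mulr_ge0 ?powR_ge0 //.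
apply: le_measure; last exact: W_set_dyadic.
- by apply: mem_set; exact: measurable_W_set.
- by apply: mem_set; exact: measurable_lim_sup_set.
Qed.

(* "Effectively computable": the exponents are recursive functions of rational
   bounds on kappa and on the Fourier l^1 dimension. *)
Theorem theorem2p1 (R : realType) :
  exists rho_a rho_b : rat -> rat -> rat,
    computable rho_a /\ computable rho_b /\
    forall (kappa : R) (nu : probability (measurableTypeR R) R),
      0 < kappa < 1 -> AD_regular kappa nu ->
      ((2^-1 : R)%:E < fourier_l1_dim nu)%E ->
      forall k s : rat, kappa <= (ratr k : R) < 1 ->
        2^-1 < s -> ((ratr s : R)%:E <= fourier_l1_dim nu)%E ->
      (0 < rho_a k s /\
       exists C : R, 0 < C /\ forall T : nat, (1 <= T)%N ->
         (rational_count (supp nu) T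
            <= (C * T%:R `^ (2 * kappa - ratr (rho_a k s)))%:E)%E)
      /\
      (0 < rho_b k s <= 1 /\
       nu (W_set (supp nu) (2 - ratr (rho_b k s))) = 0%E).
Proof.
exists rho_exponent, rho_exponent.
do 2![split; first exact: computable_rho_exponent].
move=> kappa nu /andP[kappa0 kappa1] reg_nu _ k s k_bounds s2 s_dim.
have [k_ge k1] := andP k_bounds; have k01 : 0 < k < 1.
  by rewrite -(ltr0q R) -(ltr_rat R k) rmorph1 k1 (lt_le_trans kappa0).
have [rho0 rho1] := andP (rho_exponent_gt0_le1 k01 s2).
have [v [v01 v_s] rho_v] := ratr_rho_exponent_le k_bounds s2.
have [A A0 regA] := AD_regular_on_supp (ltW kappa0) reg_nu.
have v_dim : (((1 + v) / 2)%:E < fourier_l1_dim nu)%E.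
  by rewrite (lt_le_trans _ s_dim) ?lte_fin.
have [C C0 count_v] := rational_count_powR_le A0 regA (ltW kappa1) v01 v_dim.
set rho := ratr (rho_exponent k s) in rho_v *.
have count_rho T : (1 <= T)%N ->
    (rational_count (supp nu) T <= (C * T%:R `^ (2 * kappa - rho))%:E)%E.
  move=> T1; rewrite (le_trans (count_v T T1)) // lee_fin ler_pM2l //.
  by rewrite ler_powR ?ler1n // lerD2l lerN2.
have rho_bounds : 0 < rho <= 1.
  by rewrite ltr0q rho0 -(rmorph1 (ratr : rat -> R)) ler_rat.
split; first by split=> //; exists C.
split; first by rewrite rho0.
by apply: (measure_W_set_eq0 (ltW A0) regA _ _ (ltW C0) count_rho); nra.
Qed.
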